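(* Let $X$ be a real Hilbert space and $Y$ a closed subspace of $X$. Let $S\colon X\to Y$ be a bounded linear operator such that the restriction $S|_Y\colon Y\to Y$ is surjective and injective, and such that $\langle x, Sx\rangle+\tfrac12\|Sx\|^2=0$ for all $x\in X$. Let $f\in\Gamma_0(X)$ with $f^*|_Y\in\Gamma_0(Y)$. Then the multifunction $[\partial(f^*|_Y)]\circ S|_Y\colon Y\rightrightarrows Y$ has a unique fixed point $e$ (i.e. a unique $e\in Y$ with $e\in\partial(f^*|_Y)(Se)$), and $$x\in X \text{ and } Sx\in\partial f(x)\ \Longrightarrow\ Sx=Se.$$ Furthermore: (a) If $x\in X$, $f(x)\in\mathbb{R}$ and $f(x)\le (f^*|_Y)^*(e)$, then $$Sx\in\partial f(x)\iff f^*(Sx)+\tfrac12\|Sx\|^2+f(x)=0\iff Sx=Se.$$ (b) If $x\in X$ and $f(x)=\min_X f$, then the equivalences in (a) hold, i.e. $Sx\in\partial f(x)\iff f^*(Sx)+\tfrac12\|Sx\|^2+f(x)=0\iff Sx=Se$.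
   Context: For a real Hilbert space $H$, $\Gamma_0(H)$ is the set of proper, convex, lower semicontinuous functions $H\to\,]-\infty,\infty]$. $f^*$ denotes the Fenchel conjugate of $f$ on $X$, $f^*(u)=\sup_{x\in X}(\langle x,u\rangle-f(x))$; $f^*|_Y$ is its restriction to $Y$, regarded as a function on the Hilbert space $Y$; $(f^*|_Y)^*$ is the Fenchel conjugate of $f^*|_Y$ computed in $Y$, and $\partial(f^*|_Y)$ is its subdifferential in $Y$. $\partial f$ is the subdifferential of $f$ on $X$. Since $Y\subseteq X$, $Sx\in Y$ is also regarded as an element of $X$. *)

(* Defs.v *)
(* Real Hilbert spaces are modelled as complete
   normed modules over a realType R together with an inner product that
   induces the norm. Closed subspaces are modelled as subsets Y of X. *)
From HB Require Import structures.
From mathcomp Require Import all_boot all_order all_algebra.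
From mathcomp Require Import all_classical all_reals all_analysis.
Set Implicit Arguments. Unset Strict Implicit. Unset Printing Implicit Defensive.
Import Order.TTheory GRing.Theory Num.Theory.
Import numFieldNormedType.Exports.
Local Open Scope classical_set_scope.
Local Open Scope ring_scope.

Section Defs.
Context {R : realType} {X : completeNormedModType R}.

Definition is_inner_product (inner : X -> X -> R) : Prop :=
  [/\ (forall x y, inner x y = inner y x),
      (forall a x y z, inner (a *: x + y) z = a * inner x z + inner y z)
    & (forall x, `|x| ^+ 2 = inner x x)].

Definition closed_subspace (Y : set X) : Prop :=
  [/\ Y 0, (forall a x y, Y x -> Y y -> Y (a *: x + y)) & closed Y].

Definition bounded_linear (S : X -> X) : Prop :=
  (forall a x y, S (a *: x + y) = a *: S x + S y) /\
  exists M : R, forall x, `|S x| <= M * `|x|.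

Local Open Scope ereal_scope.

Definition proper_on (D : set X) (g : X -> \bar R) : Prop :=
  (forall x, D x -> g x != -oo) /\ exists x, D x /\ g x \is a fin_num.

Definition convex_on (D : set X) (g : X -> \bar R) : Prop :=
  forall x y (t : R), D x -> D y -> (0 < t < 1)%R ->
    g (t *: x + (1 - t) *: y)%R <= t%:E * g x + (1 - t)%:E * g y.

Definition lsc_on (D : set X) (g : X -> \bar R) : Prop :=
  forall a : R, closed (D `&` [set x | g x <= a%:E]).

Definition Gamma0_on (D : set X) (g : X -> \bar R) : Prop :=
  [/\ proper_on D g, convex_on D g & lsc_on D g].

Definition conj_on (inner : X -> X -> R) (D : set X) (g : X -> \bar R) (u : X)
  : \bar R := ereal_sup [set (inner x u)%:E - g x | x in D].

Definition subdiff_on (inner : X -> X -> R) (D : set X) (g : X -> \bar R) (x : X)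
  : set X :=
  [set u | D u /\ forall z, D z -> g x + (inner (z - x)%R u)%:E <= g z].

End Defs.

(* Main.v *)
(* Let [g] be the restriction of [f^*] to [Y] and [T] the inverse of [S] on [Y].
   The identity on [S] says [<T w, w> = - |w|^2 / 2], so [T] has the everywhere
   defined adjoint [- T - 1] and is bounded, by uniform boundedness. Since [-T]
   is then strongly monotone and Lipschitz, [w |-> prox (w + r T w)] is a
   contraction for small [r]; its fixed point satisfies [T w \in dg(w)], and
   [e = T w] is the point sought. Uniqueness and the equality [S x = S e] come
   from [<S x - S y, x - y> = - |S x - S y|^2 / 2], which is nonnegative only
   if [S x = S y]; the remaining equivalences are cases of equality in the
   Fenchel-Young inequality. *)
Require Import Defs.
From HB Require Import structures.
From mathcomp Require Import all_boot all_order all_algebra.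
From mathcomp Require Import all_classical all_reals all_analysis.
From mathcomp Require Import ring lra.
Import Order.TTheory GRing.Theory Num.Theory.
Import numFieldNormedType.Exports.
Local Open Scope classical_set_scope.
Local Open Scope ring_scope.

(** * Inner product identities and the Cauchy-Schwarz inequality *)

Section InnerProduct.
Context {R : realType} {X : completeNormedModType R} {inner : X -> X -> R}.
Context (ip : is_inner_product inner).
Implicit Types (x y z : X) (a : R).

Lemma innerC x y : inner x y = inner y x.
Proof. by case: ip. Qed.

Lemma inner_sqr x : inner x x = `|x| ^+ 2.
Proof. by case: ip. Qed.

Lemma innerDl x y z : inner (x + y) z = inner x z + inner y z.
Proof. by case: ip => _ L _; rewrite -[x]scale1r L scale1r mul1r. Qed.

Lemma inner0l z : inner 0 z = 0.
Proof. by apply: (addrI (inner 0 z)); rewrite -innerDl !addr0. Qed.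

Lemma innerZl a x z : inner (a *: x) z = a * inner x z.
Proof. by case: ip => _ L _; rewrite -[a *: x]addr0 L inner0l addr0. Qed.

Lemma innerNl x z : inner (- x) z = - inner x z.
Proof. by rewrite -scaleN1r innerZl mulN1r. Qed.

Lemma innerBl x y z : inner (x - y) z = inner x z - inner y z.
Proof. by rewrite innerDl innerNl. Qed.

Lemma innerDr x y z : inner z (x + y) = inner z x + inner z y.
Proof. by rewrite innerC innerDl !(innerC z). Qed.

Lemma innerZr a x z : inner z (a *: x) = a * inner z x.
Proof. by rewrite innerC innerZl (innerC z). Qed.

Lemma innerNr x z : inner z (- x) = - inner z x.
Proof. by rewrite innerC innerNl (innerC z). Qed.

Lemma innerBr x y z : inner z (x - y) = inner z x - inner z y.
Proof. by rewrite innerDr innerNr. Qed.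

Lemma inner_norm_sqrD x y :
  `|x + y| ^+ 2 = `|x| ^+ 2 + 2 * inner x y + `|y| ^+ 2.
Proof.
rewrite -!inner_sqr !(innerDl, innerDr) (innerC y x); ring.
Qed.

Lemma inner_norm_sqrB x y :
  `|x - y| ^+ 2 = `|x| ^+ 2 - 2 * inner x y + `|y| ^+ 2.
Proof. by rewrite inner_norm_sqrD innerNr normrN mulrN. Qed.

Lemma inner_le_norm x y : inner x y <= `|x| * `|y|.
Proof.
have [->|x0] := eqVneq x 0; first by rewrite inner0l normr0 mul0r.
have [->|y0] := eqVneq y 0; first by rewrite innerC inner0l normr0 mulr0.
have p : 0 < `|x| * `|y| by rewrite mulr_gt0 // normr_gt0.
rewrite -subr_ge0 -(pmulr_rge0 _ p).
(* The square expands to [2 |x| |y| (|x| |y| - <x, y>)]. *)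
have := sqr_ge0 `| `|y| *: x - `|x| *: y |.
rewrite inner_norm_sqrB innerZl innerZr !normrZ !normr_id; nra.
Qed.

Lemma normr_inner_le x y : `|inner x y| <= `|x| * `|y|.
Proof.
rewrite ler_norml inner_le_norm andbT -[leRHS]opprK lerN2 -innerNl.
by rewrite (le_trans (inner_le_norm _ _)) // normrN.
Qed.

(** * Strongly convex minimization and proximal points *)

(* By the parallelogram law, the values of a strongly convex function control the
   distance between almost-minimizers, so a minimizing sequence is Cauchy. *)
Lemma strongly_convex_min (D : set X) (h : X -> R) (x0 v : X) (c l : R) :
  D !=set0 -> 0 < l ->
  (forall x y t, D x -> D y -> 0 < t < 1 ->
    D (t *: x + (1 - t) *: y) /\
    h (t *: x + (1 - t) *: y) <= t * h x + (1 - t) * h y) ->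
  (forall a, closed (D `&` [set x | h x <= a])) ->
  (forall x, D x -> inner x0 x - c <= h x) ->
  exists2 p, D p & forall z, D z ->
    h p + l / 2 * `|p - v| ^+ 2 <= h z + l / 2 * `|z - v| ^+ 2.
Proof.
move=> [d Dd] l0 Hc Hl Hm.
pose G z := h z + l / 2 * `|z - v| ^+ 2.
pose A := [set G z | z in D].
(* Completing the square in the quadratic term plus the affine minorant, with centre [v - x0 / l],
   gives this constant. *)
have lb z : D z -> inner x0 v - c - (2 * l)^-1 * `|x0| ^+ 2 <= G z.
  move=> Dz.
  have := sqr_ge0 `|(z - v) + l^-1 *: x0|.
  rewrite inner_norm_sqrD innerZr (innerC (z - v)) innerBr normrZ exprMn.
  rewrite real_normK ?num_real //.
  rewrite -(pmulr_rge0 _ (divr_gt0 l0 (ltr0n R 2))) => H.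
  have E a b k : l / 2 * (a + 2 * (l^-1 * b) + l^-1 ^+ 2 * k) =
      l / 2 * a + b + (2 * l)^-1 * k by field; rewrite gt_eqF.
  by have := Hm _ Dz; rewrite /G E in H *; lra.
have hA : has_inf A.
  split; first by exists (G d), d.
  exists (inner x0 v - c - (2 * l)^-1 * `|x0| ^+ 2) => _ [z Dz <-].
  exact: lb.
have mle z : D z -> inf A <= G z.
  by move=> Dz; apply: ge_inf; [case: hA | exists z].
have /choice[u Hu] : forall n : nat, exists z, D z /\ G z < inf A + n.+1%:R^-1.
  move=> n; have n0 : 0 < n.+1%:R^-1 :> R by rewrite invr_gt0.
  by have [_ [z Dz <-] ?] := inf_adherent n0 hA; exists z.
have mid x y : D x -> D y -> l / 4 * `|x - y| ^+ 2 <= G x + G y - 2 * inf A.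
  move=> Dx Dy; have [Dm hm] := Hc x y 2^-1 Dx Dy ltac:(lra).
  have := mle _ Dm; rewrite /G.
  have -> : 2^-1 *: x + (1 - 2^-1) *: y - v = 2^-1 *: ((x - v) + (y - v)).
    have -> : 1 - 2^-1 = 2^-1 :> R by field.
    have hv : v = 2^-1 *: (v + v).
      by rewrite -[v + v]mulr2n -[v *+ 2]scaler_nat scalerA mulVf ?scale1r.
    by rewrite addrACA -opprD -scalerDr scalerBr -hv.
  have -> : x - y = (x - v) - (y - v) by rewrite opprB addrA subrK.
  rewrite normrZ exprMn (inner_norm_sqrD (x - v) (y - v)).
  by rewrite (inner_norm_sqrB (x - v)) ger0_norm //; move: hm; rewrite /G; lra.
have cu : cvgn u.
  apply/cauchy_cvgP/cauchy_exP => e e0.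
  (* Two values within [l / 8 * e ^+ 2] of the infimum add up to the [l / 4 * e ^+ 2] that [mid]
     needs. *)
  have d0 : 0 < l / 8 * e ^+ 2 by rewrite mulr_gt0 ?exprn_gt0 // divr_gt0.
  have [N _ HN] := near_infty_natSinv_lt (PosNum d0).
  exists (u N), N => // n /= Nn; rewrite -ball_normE /=.
  have [DN GN] := Hu N; have [Dn Gn] := Hu n.
  have hN : N.+1%:R^-1 < l / 8 * e ^+ 2 := HN N (leqnn N).
  have hn : n.+1%:R^-1 < l / 8 * e ^+ 2 := HN n Nn.
  rewrite -(ltr_pXn2r (n:=2)) ?nnegrE // ?(ltW e0) //.
  have l4 : 0 < l / 4 by rewrite divr_gt0.
  have := mid _ _ DN Dn.
  rewrite -(ltr_pM2l l4).
  have GN' : G (u N) < inf A + l / 8 * e ^+ 2 by rewrite (lt_trans GN) ?ltrD2l.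
  have Gn' : G (u n) < inf A + l / 8 * e ^+ 2 by rewrite (lt_trans Gn) ?ltrD2l.
  by move: GN' Gn'; clear; lra.
pose p := lim (u @ \oo).
(* Closed sublevel sets transfer only constant bounds to the limit. The quadratic term converges, so
   [h (u n)] is eventually below this constant, with slack [e]. *)
have near_h e : 0 < e ->
    D p /\ h p <= inf A + e - l / 2 * `|p - v| ^+ 2.
  move=> e0.
  apply: (closed_cvg _ (Hl _) _ _ cu).
  have cn : l / 2 * `|u n - v| ^+ 2 @[n --> \oo] --> l / 2 * `|p - v| ^+ 2.
    apply: cvgMr => //; rewrite expr2; apply: cvgM;
      by apply: cvg_norm; apply: cvgB => //; exact: cvg_cst.
  have e2 : 0 < e / 2 by rewrite divr_gt0.
  have g := cvgr_gt _ cn (l / 2 * `|p - v| ^+ 2 - e / 2) ltac:(lra).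
  have s := near_infty_natSinv_lt (PosNum e2).
  near=> n.
  have [Dn Gn] := Hu n; split => //=.
  have n1 : n.+1%:R^-1 < e / 2 by near: n.
  have n2 : l / 2 * `|p - v| ^+ 2 - e / 2 < l / 2 * `|u n - v| ^+ 2 by near: n.
  have := lt_trans Gn (_ : _ < inf A + e / 2); rewrite ltrD2l => /(_ n1).
  by move: n2; rewrite /G; clear; lra.
exists p; first by have [] := near_h 1 ltac:(lra).
move=> z Dz; apply/ler_addgt0Pr => e e0.
have [_] := near_h e e0; have := mle z Dz; rewrite /G; lra.
Unshelve. all: by end_near. Qed.

(* The first-order condition comes from comparing [p] with [t z + (1 - t) p]
   and letting [t] tend to [0]. *)
Lemma proximal_point (D : set X) (h : X -> R) (x0 v : X) (c l : R) :
  D !=set0 -> 0 < l ->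
  (forall x y t, D x -> D y -> 0 < t < 1 ->
    D (t *: x + (1 - t) *: y) /\
    h (t *: x + (1 - t) *: y) <= t * h x + (1 - t) * h y) ->
  (forall a, closed (D `&` [set x | h x <= a])) ->
  (forall x, D x -> inner x0 x - c <= h x) ->
  exists2 p, D p & forall z, D z -> h p + l * inner (z - p) (v - p) <= h z.
Proof.
move=> D0 l0 Hc Hl Hm.
have [p Dp pmin] := strongly_convex_min D h x0 v c l D0 l0 Hc Hl Hm.
exists p => // z Dz.
pose b := `|z - p| ^+ 2.
have b0 : 0 <= b by exact: sqr_ge0.
rewrite leNgt; apply/negP; set i := inner _ _ => lt.
pose k := h p + l * i - h z.
have k0 : 0 < k by rewrite /k subr_gt0.
have lb0 : 0 <= l * b by rewrite mulr_ge0 // ltW.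
(* Any [t] in []0, 1[] with [t * (l * b) / 2 < k] contradicts minimality; this one qualifies even if
   [b = 0]. *)
pose t := k / (l * b + k + 1).
have d0 : 0 < l * b + k + 1 by lra.
have t01 : 0 < t < 1.
  by rewrite divr_gt0 //= ltr_pdivrMr //; lra.
have [Dt ht] := Hc _ _ _ Dz Dp t01.
have := pmin _ Dt.
have -> : t *: z + (1 - t) *: p - v = (p - v) + t *: (z - p).
  by rewrite scalerBl scale1r scalerBr [_ + (p - _)]addrCA addrAC.
rewrite (inner_norm_sqrD (p - v)) innerZr normrZ exprMn real_normK ?num_real //.
have -> : inner (p - v) (z - p) = - i by rewrite /i -innerNr opprB innerC.
rewrite -/b => H.
have tE : t * (l * b) + t * k + t = k by rewrite /t; field; rewrite gt_eqF.
have [t0 _] := andP t01.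
have : t * k <= t * (t * (l * b) / 2) by move: ht H; rewrite /k; lra.
rewrite ler_pM2l // => ?.
have : 0 < t * k by rewrite mulr_gt0.
lra.
Qed.

(** * Projections and boundedness of operators with an adjoint *)

Lemma inner_norm_sqr_le0 x : inner x x <= 0 -> x = 0.
Proof.
rewrite inner_sqr => H; apply/eqP.
by rewrite -normr_eq0 -sqrf_eq0 eq_le H sqr_ge0.
Qed.

Lemma closed_subspaceB (Y : set X) x y :
  closed_subspace Y -> Y x -> Y y -> Y (x - y).
Proof. by case=> _ YD _ Yx Yy; rewrite addrC -scaleN1r; apply: YD. Qed.

(** The projection is the proximal point of the zero function on [Y]; testing its inequality at
    [p + y] and [p - y] gives orthogonality of [v - p] to [Y]. *)
Lemma orthogonal_projection (Y : set X) v : closed_subspace Y ->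
  exists2 p, Y p & forall y, Y y -> inner y v = inner y p.
Proof.
move=> YS; have [Y0 YD Yc] := YS.
have YZ a y : Y y -> Y (a *: y) by move=> Yy; rewrite -[_ *: _]addr0; exact: YD.
have [||x y t Dx Dy _|a|x _|p Yp pP] :=
  proximal_point Y (cst 0) 0 v 0 1 => //.
- by exists 0.
- by split; [apply: YD => //; exact: YZ | rewrite /cst; lra].
- have [a0|a0] := leP 0 a.
    by rewrite (_ : [set _ | _] = setT) ?setIT //; apply/seteqP; split.
  rewrite (_ : [set _ | _] = set0) ?setI0 //; first exact: closed0.
  by apply/seteqP; split => // x /=; rewrite leNgt a0.
- by rewrite inner0l subr0.
exists p => // y Yy.
have h1 := pP (y + p) ltac:(by rewrite -[y]scale1r; exact: YD).
have h2 := pP (- y + p) ltac:(by rewrite -scaleN1r; exact: YD).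
move: h1 h2; rewrite /cst !addrK innerNl innerBr; lra.
Qed.

(* Uniform boundedness applied to the functionals [<T y, .> / |y|]. *)
Lemma adjoint_bounded (Y : set X) (T T' : X -> X) : closed_subspace Y ->
  (forall y, Y y -> Y (T y)) -> (forall y, Y y -> Y (T' y)) ->
  (forall y z, Y y -> Y z -> inner (T y) z = inner y (T' z)) ->
  exists M, forall y, Y y -> `|T y| <= M * `|y|.
Proof.
move=> YS YT YT' adj.
(* At [y = 0] the convention [0^-1 = 0] makes the functional vanish. *)
pose L y z : R^o := `|y|^-1 * inner (T y) z.
have [||M HM] := @Banach_Steinhauss R X R^o [set L y | y in Y] _ _ 1.
- move=> _ [y Yy <-]; split.
    move=> r; exists (`|y|^-1 * (`|T y| * r)) => x xr.
    rewrite /L normrM ger0_norm ?invr_ge0 // ler_wpM2l ?invr_ge0 //.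
    by rewrite (le_trans (normr_inner_le _ _)) // ler_wpM2l.
  by move=> a u v; rewrite /L innerDr innerZr mulrDr mulrCA.
(* The adjoint identity needs arguments in [Y], so [z] is replaced by its projection [p], and
   [|T' p|] bounds the whole family at [z]. *)
- move=> z; have [p Yp pP] := orthogonal_projection Y z YS.
  exists `|T' p| => _ [y Yy <-].
  rewrite /L pP ?adj //; last exact: YT.
  rewrite normrM ger0_norm ?invr_ge0 //.
  have [->|y0] := eqVneq y 0; first by rewrite normr0 invr0 mul0r.
  by rewrite ler_pdivrMl ?normr_gt0 // normr_inner_le.
exists M => y Yy.
have [->|Ty0] := eqVneq (T y) 0.
  rewrite normr0 mulr_ge0 // (le_trans _ (HM (L y) _ 0 _)) //;
    last by rewrite normr0.
  by exists y.
have Ty : 0 < `|T y| by rewrite normr_gt0.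
(* [T] is not assumed linear; that it kills [0] comes from the adjoint identity. *)
have y0 : y != 0.
  apply: contraNneq Ty0 => y0; apply/eqP/inner_norm_sqr_le0.
  by rewrite adj //; [rewrite y0 inner0l | exact: YT].
have := HM (L y) ltac:(by exists y) (`|T y|^-1 *: T y).
rewrite normrZ normrV ?unitfE ?gt_eqF // normr_id mulVf ?gt_eqF //.
move=> /(_ (lexx _)).
rewrite /L innerZr inner_sqr expr2 mulKf ?gt_eqF // normrM normr_id.
by rewrite normfV normr_id mulrC ler_pdivrMr // normr_gt0.
Qed.

(** * The variational inequality for a skew-type operator *)

(* A fixed point of [w |-> prox (w + r T w)], which is a contraction for
   [r = 1 / (2 M^2)], solves the variational inequality. *)
Lemma skew_variational_inequality (Y D : set X) (h : X -> R) (T : X -> X)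
    (x0 : X) (c M : R) :
  closed_subspace Y -> D `<=` Y -> D !=set0 ->
  (forall x y t, D x -> D y -> 0 < t < 1 ->
    D (t *: x + (1 - t) *: y) /\
    h (t *: x + (1 - t) *: y) <= t * h x + (1 - t) * h y) ->
  (forall a, closed (D `&` [set x | h x <= a])) ->
  (forall x, D x -> inner x0 x - c <= h x) ->
  (forall x y, Y x -> Y y ->
    inner (T x - T y) (x - y) = - (2^-1 * `|x - y| ^+ 2)) ->
  (forall x y, Y x -> Y y -> `|T x - T y| <= M * `|x - y|) ->
  exists2 w, D w & forall z, D z -> h w + inner (z - w) (T w) <= h z.
Proof.
move=> [Y0 YD Yc] DY D0 Hc Hl Hm TY TM.
(* The bound [N >= 1] makes [r] below well defined and at most [1 / 2], whatever the sign of [M]. *)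
pose N := Num.max M 1.
have N1 : 1 <= N by rewrite le_max lexx orbT.
have TN x y : Y x -> Y y -> `|T x - T y| <= N * `|x - y|.
  move=> Yx Yy; rewrite (le_trans (TM _ _ Yx Yy)) // ler_wpM2r //.
  by rewrite le_max lexx.
have N0 : 0 < 2 * N ^+ 2 by rewrite mulr_gt0 // exprn_gt0 //; lra.
pose r := (2 * N ^+ 2)^-1.
have /choice[P HP] : forall v, exists p, D p /\
    forall z, D z -> h p + 2 * N ^+ 2 * inner (z - p) (v - p) <= h z.
  move=> v; have [p Dp pP] := proximal_point D h x0 v c _ D0 N0 Hc Hl Hm.
  by exists p.
(* Adding the inequalities at [P v] and [P v'] yields firm nonexpansiveness,
   [|P v - P v'|^2 <= <P v - P v', v - v'>]. *)
have P_le v v' : `|P v - P v'| <= `|v - v'|.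
  have [Dp pP] := HP v; have [Dp' pP'] := HP v'.
  have [->|n0] := eqVneq (P v - P v') 0; first by rewrite normr0.
  have n1 : 0 < `|P v - P v'| by rewrite normr_gt0.
  rewrite -(ler_pM2l n1) -expr2 (le_trans _ (inner_le_norm _ _)) //.
  have := pP _ Dp'; have := pP' _ Dp => h1 h2.
  have : 2 * N ^+ 2 * (inner (P v - P v') (v' - P v') +
                        inner (P v' - P v) (v - P v)) <= 0 by lra.
  rewrite pmulr_rle0 // -inner_sqr !(innerBl, innerBr); lra.
pose g w := P (w + r *: T w).
have gY : {homo g : x / Y x >-> Y x}.
  by move=> x _; apply: DY; case: (HP (x + r *: T x)).
(* The squared Lipschitz constant of [w + r T w] is at most [1 - r + r^2 N^2 = 1 - r / 2], which is
   below [(1 - r / 4)^2]. *)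
have q0 : 0 <= 1 - r / 4.
  rewrite /r subr_ge0 ler_pdivrMr // mul1r invf_ple ?posrE //; nra.
have [w Yw wE] : exists2 w, Y w & w = g w.
  have [||w Yw wE] := @banach_fixed_point R X Y (mkfun_fun gY) _ Yc.
  - exists (NngNum q0); split => /=.
      by rewrite gtrBl divr_gt0 // invr_gt0.
    move=> [x y] [/= Yx Yy]; rewrite (le_trans (P_le _ _)) //.
    rewrite -(ler_pXn2r (n:=2)) ?nnegrE // ?mulr_ge0 //.
    have -> : x + r *: T x - (y + r *: T y) = (x - y) + r *: (T x - T y).
      by rewrite opprD addrACA scalerBr.
    rewrite inner_norm_sqrD innerZr (innerC (x - y)) TY // normrZ !exprMn.
    rewrite real_normK ?num_real //.
    have : `|T x - T y| ^+ 2 <= (N * `|x - y|) ^+ 2.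
      by rewrite ler_pXn2r ?nnegrE ?mulr_ge0 ?TN //; lra.
    have r0 : 0 < r by rewrite invr_gt0.
    rewrite -(ler_pM2l (exprn_gt0 2 r0)) exprMn.
    have -> : r ^+ 2 * (N ^+ 2 * `|x - y| ^+ 2) = r / 2 * `|x - y| ^+ 2.
      by rewrite /r; field; lra.
    have := mulr_ge0 (sqr_ge0 (r / 4)) (sqr_ge0 `|x - y|).
    lra.
  - by exists 0.
  by exists w.
have [Dw wP] := HP (w + r *: T w).
move: Dw wP; rewrite -/(g w) -wE => Dw wP; exists w => // z Dz.
have := wP _ Dz; rewrite addrAC subrr add0r innerZr.
by rewrite /r mulrA divff ?mul1r // gt_eqF.
Qed.

End InnerProduct.

(** * Fenchel conjugates and subdifferentials *)

Section Conjugate.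
Context {R : realType} {X : completeNormedModType R} {inner : X -> X -> R}.
Context (ip : is_inner_product inner).
Implicit Types (D : set X) (g : X -> \bar R) (x u : X).
Local Open Scope ereal_scope.

Lemma fenchel_young D g x u : D x ->
  (inner x u)%:E - g x <= conj_on inner D g u.
Proof. by move=> Dx; apply: ereal_sup_ubound; exists x. Qed.

Lemma subdiff_on_fin D g x u : proper_on D g -> D x ->
  subdiff_on inner D g x u -> g x \is a fin_num.
Proof.
move=> [gN [z [Dz gz]]] Dx [_ /(_ z Dz)].
by have := gN x Dx; move: gz; case: (g x); case: (g z).
Qed.

(** Both sides say that [z |-> <z, u> - g z] attains its supremum over [D] at [x]. *)
Lemma subdiff_onE D g x u : D x -> D u -> g x \is a fin_num ->
  subdiff_on inner D g x u <->
  conj_on inner D g u = (inner x u)%:E - g x.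
Proof.
move=> Dx Du gx; split => [[_ H]|H].
- apply/eqP; rewrite eq_le fenchel_young // andbT.
  apply: ge_ereal_sup => _ [z Dz <-].
  have := H z Dz; move: gx; case: (g x) => // a _; case: (g z) => //=.
  + by move=> b; rewrite -!EFinD !lee_fin innerBl //; lra.
  + by rewrite addeNy leNye.
- split => // z Dz; have := fenchel_young D g z u Dz.
  rewrite H; move: gx; case: (g x) => // a _; case: (g z) => //=.
  + by move=> b; rewrite -!EFinD !lee_fin innerBl //; lra.
  + by rewrite leey.
Qed.

End Conjugate.

(** * The fixed point and the equivalences *)

Theorem theorem3p1 (R : realType) (X : completeNormedModType R)
  (inner : X -> X -> R) (Y : set X) (S : X -> X) (f : X -> \bar R) :
  is_inner_product inner ->
  closed_subspace Y ->
  bounded_linear S ->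
  (forall x, Y (S x)) ->
  {in Y &, injective S} ->
  (forall y, Y y -> exists2 x, Y x & S x = y) ->
  (forall x, inner x (S x) + 2^-1 * `|S x| ^+ 2 = 0) ->
  Gamma0_on setT f ->
  Gamma0_on Y (conj_on inner setT f) ->
  exists e,
    [/\ (Y e /\ subdiff_on inner Y (conj_on inner setT f) (S e) e),
        (forall e', Y e' ->
           subdiff_on inner Y (conj_on inner setT f) (S e') e' -> e' = e),
        (forall x, subdiff_on inner setT f x (S x) -> S x = S e),
        (forall x, f x \is a fin_num ->
           (f x <= conj_on inner Y (conj_on inner setT f) e)%E ->
           (subdiff_on inner setT f x (S x) <->
              (conj_on inner setT f (S x) + (2^-1 * `|S x| ^+ 2)%:E + f x = 0)%E)
           /\
           ((conj_on inner setT f (S x) + (2^-1 * `|S x| ^+ 2)%:E + f x = 0)%E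
              <-> S x = S e))
      & (forall x, (forall z, f x <= f z)%E ->
           (subdiff_on inner setT f x (S x) <->
              (conj_on inner setT f (S x) + (2^-1 * `|S x| ^+ 2)%:E + f x = 0)%E)
           /\
           ((conj_on inner setT f (S x) + (2^-1 * `|S x| ^+ 2)%:E + f x = 0)%E
              <-> S x = S e))].
Proof.
move=> ip YS SL SY Sinj Ssurj Sid [fprop _ _] gG.
have [Y0 YD Yc] := YS; have [SD _] := SL.
set g := conj_on inner setT f in gG *.
have [gprop gconv glsc] := gG.
have SB x y : S (x - y) = S x - S y.
  by rewrite addrC -scaleN1r SD scaleN1r addrC.
have S0 : S 0 = 0 by have := SB 0 0; rewrite !subrr.
have SId x y : inner (S x - S y) (x - y) = - (2^-1 * `|S x - S y| ^+ 2).
  by rewrite -SB (innerC ip); have := Sid (x - y); lra.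
have YB x y : Y x -> Y y -> Y (x - y) by exact: closed_subspaceB.
have inj x y : Y x -> Y y -> S x = S y -> x = y.
  by move=> Yx Yy; apply: Sinj; rewrite inE.
have /choice[T HT] : forall y, exists x, Y y -> Y x /\ S x = y.
  move=> y; have [/Ssurj[x Yx Sx]|nY] := pselect (Y y); first by exists x.
  by exists 0.
have YT y : Y y -> Y (T y) by move=> /HT[].
have ST y : Y y -> S (T y) = y by move=> /HT[].
have TB x y : Y x -> Y y -> T (x - y) = T x - T y.
  by move=> Yx Yy; apply: inj; rewrite ?SB ?ST //; auto.
have [M HM] : exists M, forall y, Y y -> `|T y| <= M * `|y|.
  apply: (adjoint_bounded ip Y T (fun z => - T z - z)) => //.
    by move=> y Yy; rewrite -[- T y]sub0r; apply: (YB) => //; apply: YB; auto.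
  (* Polarization: the identity at [T y + T z], minus those at [T y] and [T z], gives
     [<T y, z> + <y, T z> = - <y, z>]. *)
  move=> y z Yy Yz; have := SId (T y) (- T z).
  have -> : S (- T z) = - z by rewrite -sub0r SB S0 sub0r ST.
  have := SId (T y) 0; have := SId (T z) 0.
  rewrite S0 !subr0 !opprK !ST // (inner_norm_sqrD ip).
  rewrite !(innerDl ip, innerDr ip, innerNr ip, innerBr ip).
  by rewrite (innerC ip z (T y)); lra.
have [x0 [_ fx0]] := fprop.2.
(* Restricting [g] to its effective domain makes it real-valued, as the variational inequality
   requires. *)
pose D := [set x | Y x /\ g x \is a fin_num].
have gE x : D x -> g x = (fine (g x))%:E by case=> _ /fineK.
have DP x : D x <-> Y x /\ (g x < +oo)%E.
  split=> [[Yx gx]|[Yx gx]]; split => //; first by rewrite ltey_eq gx.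
  by rewrite fin_numE gprop.1 //= lt_eqF.
have [w Dw wP] : exists2 w, D w & forall z, D z ->
    fine (g w) + inner (z - w) (T w) <= fine (g z).
  apply: (skew_variational_inequality ip Y D _ T x0 (fine (f x0)) M) => //.
  - by move=> x [].
  - by have [z [Yz gz]] := gprop.2; exists z.
  - move=> x y t Dx Dy t01; have [Yx _] := Dx; have [Yy _] := Dy.
    have := gconv x y t Yx Yy t01; rewrite (gE _ Dx) (gE _ Dy) -!EFinM -EFinD.
    set z := _ + _ => H.
    have Dz : D z.
      apply/DP; split; last by rewrite (le_lt_trans H) // ltry.
      by apply: (YD) => //; rewrite -[_ *: _]addr0; exact: YD.
    by move: H; rewrite (gE _ Dz) lee_fin.
  - move=> a; suff -> : D `&` [set x | fine (g x) <= a] =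
      Y `&` [set x | (g x <= a%:E)%E] by exact: glsc.
    apply/seteqP; split => x /=.
      by move=> [Dx gx]; split; [case: Dx | rewrite (gE _ Dx) lee_fin].
    move=> [Yx gx]; have Dx : D x.
        by apply/DP; split => //; rewrite (le_lt_trans gx) // ltry.
    by split => //; move: gx; rewrite (gE _ Dx) lee_fin.
  (* A point [x0] where [f] is finite supplies the affine minorant [<x0, .> - f x0] of [f^*]. *)
  - move=> x Dx; have := @fenchel_young R X inner setT f x0 x I.
    by rewrite -/g (gE _ Dx) -(fineK fx0) -EFinB lee_fin.
  - by move=> x y Yx Yy; have := SId (T x) (T y); rewrite !ST // (innerC ip).
  - by move=> x y Yx Yy; rewrite -TB // HM //; auto.
have [Yw gw] := Dw.
pose e := T w; have Ye : Y e by exact: YT.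
have Se : S e = w by exact: ST.
have eP : subdiff_on inner Y g (S e) e.
  split=> // z Yz; rewrite Se (gE _ Dw).
  have [Dz|nDz] := pselect (D z).
    by rewrite (gE _ Dz) -EFinD lee_fin wP.
  suff -> : g z = +oo%E by rewrite leey.
  by apply/eqP; rewrite -leye_eq leNgt; apply/negP => gz; apply/nDz/DP.
have gconj : (conj_on inner Y g e = (inner (S e) e)%:E - g (S e))%E.
  by apply/(subdiff_onE ip) => //; rewrite Se.
have S_eq x y : 0 <= inner (S x - S y) (x - y) -> S x = S y.
  rewrite SId oppr_ge0 pmulr_rle0 // -(inner_sqr ip) => H.
  by apply: subr0_eq; apply: (inner_norm_sqr_le0 ip).
have subdiff_Se x : subdiff_on inner setT f x (S x) -> S x = S e.
  move=> xP; have fx := subdiff_on_fin setT f x (S x) fprop I xP.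
  have := (subdiff_onE ip setT f x (S x) I I fx).1 xP; rewrite -/g.
  rewrite -(fineK fx) -EFinB => gSx.
  (* As [x] need not lie in [Y], monotonicity on [Y] does not apply. The subgradient inequality of
     [e] at [S x], added to Fenchel-Young for [f] at [(x, S e)], still gives
     [<S x - S e, x - e> >= 0]. *)
  have := eP.2 (S x) (SY x); rewrite gSx Se (gE _ Dw) -EFinD lee_fin => h1.
  have := @fenchel_young R X inner setT f x w I.
  rewrite -/g (gE _ Dw) -(fineK fx) -EFinB lee_fin => h2.
  rewrite -Se; apply: S_eq; rewrite Se; move: h1 h2.
  rewrite !(innerBl ip, innerBr ip) (innerC ip x w) (innerC ip x (S x)); lra.
have iff1 x : f x \is a fin_num ->
    subdiff_on inner setT f x (S x) <->
    (g (S x) + (2^-1 * `|S x| ^+ 2)%:E + f x = 0)%E.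
  move=> fx; have Sx := Sid x.
  apply: (iff_trans (subdiff_onE ip setT f x (S x) I I fx)); rewrite -/g.
  rewrite -(fineK fx) -EFinB; case: (g (S x)) => //= r.
  by rewrite -!EFinD; split => [[]|[]] ?; congr EFin; lra.
have partA x : f x \is a fin_num -> (f x <= conj_on inner Y g e)%E ->
    (subdiff_on inner setT f x (S x) <->
       (g (S x) + (2^-1 * `|S x| ^+ 2)%:E + f x = 0)%E) /\
    ((g (S x) + (2^-1 * `|S x| ^+ 2)%:E + f x = 0)%E <-> S x = S e).
  move=> fx fxe; split; first exact: iff1.
  split=> [/(iff1 x fx)|Sx]; first exact: subdiff_Se.
  (* Fenchel-Young makes the sum nonnegative; the bound on [f x], whose right side is
     [- |S e|^2 / 2 - g (S e)], makes it nonpositive. *)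
  have := @fenchel_young R X inner setT f x (S x) I; rewrite -/g.
  move: fxe; rewrite gconj -Sx.
  have Ds : D (S x) by rewrite Sx Se.
  rewrite (gE _ Ds) -(fineK fx) -!EFinB !lee_fin -!EFinD => h1 h2.
  congr EFin; have := Sid x; have := Sid e; move: h1 h2; rewrite -Sx.
  by rewrite (innerC ip e); lra.
exists e; split => //.
- move=> e' Ye' e'P; apply: inj => //; apply: S_eq.
  have De' : D (S e') by split => //; exact: subdiff_on_fin gprop (SY e') e'P.
  have := eP.2 (S e') (SY e'); have := e'P.2 (S e) (SY e).
  rewrite Se (gE _ Dw) (gE _ De') -!EFinD !lee_fin.
  rewrite !(innerBl ip, innerBr ip); lra.
- move=> x fmin; have fx : f x \is a fin_num.
    rewrite fin_numE fprop.1 //= -ltey (le_lt_trans (fmin x0)) //.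
    by rewrite ltey_eq fx0.
  apply: partA => //.
  (* Since [0] lies in [Y], the conjugate of [g] at [e] is at least [- f^*(0)], which is the minimum
     of [f]. *)
  have := @fenchel_young R X inner Y g 0 e Y0; rewrite (inner0l ip).
  apply: le_trans; rewrite sub0e leeNr; apply: ge_ereal_sup => _ [z _ <-].
  by rewrite (innerC ip) (inner0l ip) sub0e leeN2.
Qed.
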